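(* Let $X=(x_k:k\in\mathbb{N})$ be a $\Re$-Leja sequence. For every $n\in\mathbb{N}$, the underlying set of $X_{2^n+1}=(x_0,\dots,x_{2^n})$ is the set of Chebyshev-Lobatto points $$\mathcal{L}_{2^n}=\{\cos(j\pi/2^n): j=0,\dots,2^n\}.$$
   Context: $\mathbb{N}=\{0,1,2,\dots\}$. Let $D=\{z\in\mathbb{C}: |z|\le 1\}$. A Leja sequence (for $D$) is a sequence $E=(e_k: k\in\mathbb{N})$ of points of $D$ with $e_0=1$ and, for every $j\ge 1$, $\prod_{m=0}^{j-1}|e_j-e_m|=\max_{z\in D}\prod_{m=0}^{j-1}|z-e_m|$. A $\Re$-Leja sequence is a sequence $X=X(E)$ in $[-1,1]$ for which there is a Leja sequence $E=(e_k:k\in\mathbb{N})$ such that $X$ is obtained from the sequence of real parts $(\Re(e_k): k\in\mathbb{N})$ by eliminating repeated values (each value is kept only at its first occurrence, the order being preserved). *)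

(* Defs.v *)
From HB Require Import structures.
From mathcomp Require Import all_boot all_order all_algebra.
From mathcomp Require Import all_classical all_reals all_analysis.
From mathcomp Require Import complex.

Set Implicit Arguments.
Unset Strict Implicit.
Unset Printing Implicit Defensive.

Import Order.TTheory GRing.Theory Num.Theory.

Local Open Scope classical_set_scope.
Local Open Scope ring_scope.

(* The norm on [R[i]] takes values in [R[i]], whose partial order is
   [x <= y] iff [Im x = Im y] and [Re x <= Re y]; between moduli it is thus
   the usual order of the reals. *)
Definition unit_disk (R : realType) : set R[i] := [set z | `|z| <= 1].
Arguments unit_disk : clear implicits.

Definition is_max d (T : porderType d) (A : set T) (v : T) : Prop :=
  A v /\ ubound A v.

Definition leja_prod (R : realType) (e : nat -> R[i]) (j : nat) (z : R[i]) :
    R[i] :=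
  \prod_(m < j) `|z - e m|.

Definition leja (R : realType) (e : nat -> R[i]) : Prop :=
  [/\ forall k, unit_disk R (e k),
      e 0%N = 1 &
      forall j, (1 <= j)%N ->
        is_max [set leja_prod e j z | z in unit_disk R] (leja_prod e j (e j))].

Definition first_occurrence (T : Type) (u : nat -> T) (m : nat) : Prop :=
  forall i, (i < m)%N -> u i <> u m.

(* [x] is [u] without its repeated values: [phi] enumerates increasingly all
   the indices at which [u] takes a new value. Such a total [x] exists only if
   [u] takes infinitely many values. *)
Definition dedup_of (T : Type) (u x : nat -> T) : Prop :=
  exists phi : nat -> nat,
    [/\ {homo phi : k l / (k < l)%N},
        range phi = first_occurrence u &
        forall k, x k = u (phi k)].

Definition re_leja (R : realType) (x : nat -> R) : Prop :=
  (forall k, -1 <= x k <= 1) /\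
  exists e : nat -> R[i], leja e /\ dedup_of (fun k => complex.Re (e k)) x.

Definition chebyshev_lobatto (R : realType) (N : nat) : set R :=
  [set cos (j%:R * pi / N%:R) | j in [set j : nat | (j <= N)%N]].
Arguments chebyshev_lobatto : clear implicits.

(* Main.v *)
(* If the first N = 2^n points of a Leja sequence e are the N-th roots of unity,
   then e_N =: r maximizes |z^N - 1|, so r^N = -1. Put f_m = e_(N+m) / r. Then
   f_j maximizes |w^N + 1| * prod_(m < j) |w - f_m|. Inductively f_0..f_(j-1)
   extends to a Leja section of length N, which consists of N-th roots of unity;
   its next point maximizes both factors at once, so f_j maximizes the second
   factor. Thus f_0..f_(N-1) is again a Leja section, whose points are the N-th
   roots of unity, and e_0..e_(2N-1) are the 2N-th ones. Their real parts are
   the N + 1 Chebyshev-Lobatto points. *)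
Require Import Defs.
From HB Require Import structures.
From mathcomp Require Import all_boot all_order all_algebra.
From mathcomp Require Import all_classical all_reals all_analysis.
From mathcomp Require Import complex.
From mathcomp Require Import ring lra zify.

Import Order.TTheory GRing.Theory Num.Theory.
Import numFieldNormedType.Exports.

Local Open Scope classical_set_scope.
Local Open Scope ring_scope.

(** * Initial segments of a sequence freed of repetitions *)

(** A value taken before index [M] also has its first occurrence before [M], and these first
    occurrences are an initial segment of the range of [phi]. As [x] is injective, the length of
    this segment is the number of distinct values. *)
Lemma dedup_of_take (T : eqType) (u x : nat -> T) (M : nat) (s : seq T) :
    dedup_of u x -> uniq s ->
    (forall v, (exists2 i, (i < M)%N & u i = v) <-> v \in s) ->
  forall v, (exists2 k, (k < size s)%N & x k = v) <-> v \in s.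
Proof.
move=> [phi [phi_incr phi_range xE]] s_uniq us.
have xI : injective x.
  have x_neq k l : (k < l)%N -> x k <> x l.
    move=> kl; rewrite !xE.
    have : first_occurrence u (phi l) by rewrite -phi_range; exists l.
    by apply; apply: phi_incr.
  by move=> k l xkl; case: (ltngtP k l) => // /x_neq; rewrite xkl.
have phi_ge k : (k <= phi k)%N.
  by elim: k => // k IH; apply: leq_ltn_trans IH (phi_incr _ _ _).
(* [c] counts the first occurrences below [M]; it exists because [phi k >= k]. *)
case: (ex_minnP (ex_intro (fun k => M <= phi k)%N M (phi_ge M))) => c Mc c_min.
have ltc k : (k < c)%N = (phi k < M)%N.
  apply/idP/idP => [kc|kM].
    by rewrite ltnNge; apply: contraL kc => /c_min; rewrite leqNgt.
  rewrite ltnNge; apply: contraL kM; rewrite -leqNgt leq_eqVlt.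
  move=> /predU1P[<-//|/phi_incr].
  by move=> /ltnW; apply: leq_trans.
have xs : map x (iota 0 c) =i s.
  move=> v; apply/mapP/idP => [[k]|/us[i iM uiv]].
    rewrite mem_iota /= add0n ltc => kM ->.
    by apply/us; exists (phi k); rewrite // xE.
  have uv : exists i, u i == v by exists i; apply/eqP.
  case: (ex_minnP uv) => m /eqP umv m_min.
  have : first_occurrence u m.
    by move=> l lm; rewrite umv => /eqP /m_min; rewrite leqNgt lm.
  rewrite -phi_range => -[k _ phik]; exists k; last by rewrite xE phik.
  rewrite mem_iota /= add0n ltc phik; apply: leq_ltn_trans iM.
  by apply: m_min; apply/eqP.
have <- : c = size s.
  rewrite -(perm_size (uniq_perm _ s_uniq xs)) ?size_map ?size_iota//.
  by rewrite map_inj_uniq ?iota_uniq.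
move=> v; rewrite -xs; split=> [[k kc <-]|/mapP[k]].
  by rewrite map_f // mem_iota.
by rewrite mem_iota => kc ->; exists k.
Qed.

(** * Chebyshev-Lobatto points as real parts of roots of unity *)

Lemma cos_sin_exp (R : realType) (t : R) (k : nat) :
  (cos t +i* sin t)%C ^+ k = (cos (k%:R * t) +i* sin (k%:R * t))%C.
Proof.
elim: k => [|k IH]; first by rewrite expr0 mul0r cos0 sin0.
rewrite exprSr IH -natr1 mulrDl mul1r cosD sinD.
apply/eqP; rewrite eq_complex /=. by apply/andP; split; apply/eqP; ring.
Qed.

(** The angles lie in [[0, pi]], where [cos] is injective. The exact count [N.+1] later fixes how
    many terms of [x] are taken. *)
Lemma chebyshev_lobatto_seq (R : realType) (N : nat) :
    (0 < N)%N ->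
  exists s : seq R, [/\ uniq s, size s = N.+1 &
    forall v, chebyshev_lobatto R N v <-> v \in s].
Proof.
move=> N0; exists [seq cos (j%:R * pi / N%:R) | j <- iota 0 N.+1]; split.
- rewrite map_inj_in_uniq ?iota_uniq// => i j.
  rewrite !mem_iota /= !add0n !ltnS.
  have NR : 0 < N%:R :> R by rewrite ltr0n.
  have h k : (k <= N)%N -> k%:R * pi / N%:R \in `[0, pi : R].
    move=> kN; rewrite in_itv /= divr_ge0 ?mulr_ge0 ?pi_ge0//= ler_pdivrMr//.
    by rewrite mulrC ler_wpM2l ?pi_ge0// ler_nat.
  move=> iN jN /(cos_inj (h _ iN) (h _ jN)).
  move=> /(divIf (lt0r_neq0 NR)) /(mulIf (lt0r_neq0 (pi_gt0 R))) /eqP.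
  by rewrite eqr_nat => /eqP.
- by rewrite size_map size_iota.
- move=> v; split=> [[j jN <-]|/mapP[j]].
    by apply: map_f; rewrite mem_iota.
  by rewrite mem_iota /= add0n ltnS => jN ->; exists j.
Qed.

(* [omega = exp (i pi / 2^n)] has order dividing [2^(n+1)] but not [2^n], as
   [omega^(2^n) = -1]; hence it is a primitive [2^(n+1)]-th root of unity. *)
Lemma Re_root_of_unity (R : realType) (n : nat) :
  [set complex.Re z | z in [set z : R[i] | z ^+ (2 ^ n.+1) = 1]] =
  chebyshev_lobatto R (2 ^ n).
Proof.
set t : R := pi / (2 ^ n)%:R.
pose omega : R[i] := (cos t +i* sin t)%C.
have N0 : (2 ^ n)%:R != 0 :> R by rewrite pnatr_eq0 expn_eq0.
have omegaX k : omega ^+ k =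
    (cos (k%:R * pi / (2 ^ n)%:R) +i* sin (k%:R * pi / (2 ^ n)%:R))%C.
  by rewrite cos_sin_exp mulrA.
have omegaN : omega ^+ (2 ^ n) = -1.
  by rewrite omegaX mulrAC divff // mul1r cospi sinpi; apply/eqP;
    rewrite eq_complex /= oppr0 !eqxx.
have omega1 : omega ^+ (2 ^ n.+1) = 1.
  by rewrite expnSr exprM omegaN sqrrN expr1n.
have omega_prim : (2 ^ n.+1).-primitive_root omega.
  have [m m_prim] := prim_order_exists (expn_gt0 2 n.+1) omega1.
  move=> /(dvdn_pfactor _ _ (isT : prime 2))[k kn mE].
  move: kn; rewrite leq_eqVlt => /predU1P[<-|kn]; first by rewrite -mE.
  have : (m %| 2 ^ n)%N by rewrite mE dvdn_exp2l.
  rewrite (prim_order_dvd m_prim) omegaN eq_sym -subr_eq0 opprK.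
  by rewrite -[1 + 1]/2%:R pnatr_eq0.
apply/seteqP; split=> [_ [z /(prim_rootP omega_prim)[i ->] <-]|_ [j jN <-]].
  case: i => i /= /ltnW iM; rewrite omegaX /=.
  have [iN|Ni] := leqP i (2 ^ n); first by exists i.
  (* Past the angle [pi], conjugation replaces the root by one in the upper half-plane with the same
     real part. *)
  exists (2 ^ n.+1 - i)%N => /=; first by rewrite leq_subLR [leqLHS]expnS; lia.
  have -> : (2 ^ n.+1 - i)%:R * pi / (2 ^ n)%:R =
      - (i%:R * pi / (2 ^ n)%:R) + pi *+ 2 :> R.
    by rewrite natrB// expnSr natrM; field.
  by rewrite cosD2pi cosN.
exists (omega ^+ j); last by rewrite omegaX.
by rewrite /= exprAC omega1 expr1n.
Qed.

(** * Finite Leja sections and their points *)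

Section LejaSections.
Variable R : realType.
Implicit Types (e f g : nat -> R[i]) (z : R[i]).

(** Terms from index [N] on (index 0 aside) are free, so a section can be continued by other terms
    than those of [e]. *)
Definition leja_section (N : nat) e : Prop :=
  e 0%N = 1 /\
  forall j, (j < N)%N ->
    `|e j| <= 1 /\
    forall z, `|z| <= 1 -> leja_prod e j z <= leja_prod e j (e j).

Lemma leja_leja_section N e : leja e -> leja_section N e.
Proof.
move=> [eD e0 emax]; split=> // j _; split; first exact: eD.
case: j => [|j] z zD; first by rewrite /leja_prod !big_ord0.
by have [_] := emax j.+1 isT; apply; exists z.
Qed.

Lemma leja_section_le (M N : nat) e :
  (M <= N)%N -> leja_section N e -> leja_section M e.
Proof.
by move=> MN [e0 eN]; split=> // j jM; apply: eN; apply: leq_trans MN.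
Qed.

Lemma eq_leja_prod e f j z :
  (forall m, (m < j)%N -> e m = f m) -> leja_prod e j z = leja_prod f j z.
Proof. by move=> ef; apply: eq_bigr => m _; rewrite ef. Qed.

Lemma continuous_sqr (T : topologicalType) (h : T -> R) :
  continuous h -> continuous (fun p => h p ^+ 2).
Proof.
move=> h_cont p; apply: (@continuous_comp _ _ _ h (fun r : R => r ^+ 2)).
  exact: h_cont.
exact: exprn_continuous.
Qed.

Lemma compact_disk : compact [set p : R * R | p.1 ^+ 2 + p.2 ^+ 2 <= 1].
Proof.
have c1 := @segment_compact R (-1) 1.
apply: (subclosed_compact _ (compact_setX c1 c1)).
- have -> : [set p : R * R | p.1 ^+ 2 + p.2 ^+ 2 <= 1] =
     (fun p : R * R => p.1 ^+ 2 + p.2 ^+ 2) @^-1` [set r | r <= 1] by [].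
  apply: preimage_closed; last exact: closed_le.
  move=> p _.
  apply: cvgD; apply: continuous_sqr => q; [exact: cvg_fst|exact: cvg_snd].
move=> [a b] /= ab1.
split; rewrite /= in_itv /=; apply/andP; split; nra.
Qed.

Lemma norm_le1_Re_Im z :
  (`|z| <= 1) = (complex.Re z ^+ 2 + complex.Im z ^+ 2 <= 1).
Proof. by rewrite -lecR add_Re2_Im2 expr_le1. Qed.

(** Squaring turns the moduli into a real polynomial in two real variables, to which the extreme
    value theorem on [R * R] applies. *)
Lemma sqr_leja_prod e j z :
  leja_prod e j z ^+ 2 =
  (\prod_(m < j) ((complex.Re z - complex.Re (e m)) ^+ 2 +
                  (complex.Im z - complex.Im (e m)) ^+ 2))%:C%C.
Proof.
rewrite rmorph_prod -prodrXl; apply: eq_bigr => m _.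
by rewrite -add_Re2_Im2 !raddfB.
Qed.

Lemma leja_prod_ge0 e j z : 0 <= leja_prod e j z.
Proof. by apply: prodr_ge0 => m _. Qed.

Lemma leja_prod_max e j :
  exists2 c, `|c| <= 1 &
    forall z, `|z| <= 1 -> leja_prod e j z <= leja_prod e j c.
Proof.
have F_cont k : continuous (fun p : R * R =>
    \prod_(m < k) ((p.1 - complex.Re (e m)) ^+ 2 +
                   (p.2 - complex.Im (e m)) ^+ 2)).
  elim: k => [|k IH] p.
    by under eq_fun do rewrite big_ord0; exact: cvg_cst.
  under eq_fun do rewrite big_ord_recr /=.
  apply: (continuousM (IH p)).
  apply: continuousD; apply: continuous_sqr => q;
    by apply: cvgB; [exact: cvg_fst || exact: cvg_snd|exact: cvg_cst].
have [|[a b]] := compact_EVT_max _ compact_disk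
  (continuous_subspaceT (F_cont j)).
  by exists (0, 0) => /=; rewrite expr0n addr0.
rewrite inE /= => ab1 Fmax; exists (a +i* b)%C; first by rewrite norm_le1_Re_Im.
move=> z z1; rewrite -ler_sqr ?nnegrE ?leja_prod_ge0// !sqr_leja_prod lecR.
by apply: (Fmax (complex.Re z, complex.Im z)); rewrite inE /= -norm_le1_Re_Im.
Qed.

(** Maximizers on the disk always exist, so they can be appended one at a time. *)
Lemma leja_section_extend (j N : nat) f :
    (0 < j <= N)%N -> leja_section j f ->
  exists2 g, (forall m, (m < j)%N -> g m = f m) & leja_section N g.
Proof.
move=> /andP[j0]; elim: N => [|N IH]; first by rewrite leqNgt j0.
rewrite leq_eqVlt => /predU1P[<- fj|jN fj]; first by exists f.
have [//|g gf [g0 gN]] := IH _ fj.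
have [c c1 cmax] := leja_prod_max g N.
have hg m : (m < N)%N -> (if m == N then c else g m) = g m.
  by case: ltngtP.
exists (fun m => if m == N then c else g m).
  by move=> m mj; rewrite hg ?gf// (leq_trans mj).
split=> [|k]; first by rewrite hg// (leq_trans j0).
rewrite ltnS leq_eqVlt => /predU1P[->|kN].
  rewrite eqxx; split=> // z z1.
  by rewrite !(eq_leja_prod _ g) ?cmax// => m /hg.
rewrite hg//; have [gk1 gkmax] := gN _ kN; split=> // z z1.
by rewrite !(eq_leja_prod _ g) ?gkmax// => m mk; apply: hg; apply: ltn_trans kN.
Qed.

(** With [u = a + ib], subtracting [a^2 + b^2 <= 1] from [(a - 1)^2 + b^2 >= 4] gives [a <= -1],
    which leaves only [a = -1] and [b = 0]. *)
Lemma norm_sub1_ge2 (u : R[i]) : `|u| <= 1 -> 2 <= `|u - 1| -> u = -1.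
Proof.
case: u => a b; rewrite norm_le1_Re_Im /= => ab1 /(lerXn2r 2).
rewrite !nnegrE normr_ge0 ler0n -add_Re2_Im2 /= => /(_ isT isT).
rewrite -natrX -[4%:R](rmorph_nat (real_complex R)) lecR => h.
have a1 : a = -1 by nra.
have b0 : b = 0 by nra.
by rewrite a1 b0; apply/eqP; rewrite eq_complex /= oppr0 !eqxx.
Qed.

(** The product form says that the section lists each [2 ^ n]-th root of unity once, and it also
    evaluates the first half of [leja_prod] in the induction. *)
Lemma leja_section_prod n e : leja_section (2 ^ n) e ->
  forall z, \prod_(m < 2 ^ n) (z - e m) = z ^+ (2 ^ n) - 1.
Proof.
elim: n e => [|n IH] e; first by move=> [e0 _] z; rewrite big_ord1 e0 expr1.
rewrite expnS mul2n -addnn; set N := (2 ^ n)%N => e2N.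
have N0 : (0 < N)%N by rewrite expn_gt0.
have eN := IH _ (leja_section_le _ _ _ (leq_addr N N) e2N).
have [_ emax] := e2N.
have prodE j z : leja_prod e (N + j) z =
    `|z ^+ N - 1| * \prod_(m < j) `|z - e (N + m)%N|.
  by rewrite /leja_prod big_split_ord /= -normr_prod eN.
pose r := e N.
have rN : r ^+ N = -1.
  have [|r1 rmax] := emax N; first by rewrite -[ltnLHS]addn0 ltn_add2l.
  apply: norm_sub1_ge2; first by rewrite normrX exprn_ile1.
  (* Any [N]-th root of -1 attains the bound 2 for the modulus of [z ^+ N - 1], so the maximizer [r]
     attains it too. *)
  have wN : (N.-root (-1 : R[i])) ^+ N = -1 by rewrite rootCK.
  have w1 : `|N.-root (-1 : R[i])| <= 1.
    by rewrite -(@expr_le1 _ N)// -normrX wN normrN1.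
  have := rmax _ w1; rewrite -[N in leja_prod _ N]addn0 !prodE !big_ord0 !mulr1.
  by rewrite wN -opprD normrN -[1 + 1]/2%:R normr_nat.
have r1 : `|r| = 1.
  by apply/eqP; rewrite -(@pexpr_eq1 _ _ N)// -normrX rN normrN1.
have r0 : r != 0 by rewrite -normr_eq0 r1 oner_eq0.
pose f m := e (N + m)%N / r.
have ef m : e (N + m)%N = r * f m by rewrite mulrC divfK.
have prodfE j w : leja_prod e (N + j) (r * w) = `|w ^+ N + 1| * leja_prod f j w.
  rewrite prodE exprMn rN mulN1r -opprD normrN; congr (_ * _).
  by apply: eq_bigr => m _; rewrite ef -mulrBr normrM r1 mul1r.
have fN j : (j <= N)%N -> leja_section j f.
  have f0 : f 0%N = 1 by rewrite /f addn0 divff.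
  elim: j => [|j IHj] jN; first by split.
  have fj := IHj (ltnW jN); split=> // k; rewrite ltnS leq_eqVlt.
  case/predU1P => [->|kj]; last by have [_] := fj; apply.
  have [|ej1 ejmax] := emax (N + j)%N; first by rewrite ltn_add2l.
  have fj1 : `|f j| <= 1 by rewrite normf_div r1 divr1.
  split=> // w w1.
  have [->|j0] := posnP j; first by rewrite /leja_prod !big_ord0.
  (* The term [f j] is not yet known to be a root of unity; the competitor [g j] is, by the outer
     induction hypothesis applied to [g]. *)
  have [|g gf gN] := leja_section_extend j N f _ fj; first by rewrite j0 ltnW.
  have gjN : g j ^+ N = 1.
    apply/eqP; rewrite -subr_eq0 -(IH _ gN) (bigD1 (Ordinal jN)) //=.
    by rewrite subrr mul0r.
  have [gj1 gjmax] := gN.2 _ jN.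
  have le_g : leja_prod f j w <= leja_prod f j (g j).
    by rewrite -!(eq_leja_prod g f)// gjmax.
  (* At [g j] the factor coming from [w ^+ N + 1] is exactly 2, and at [f j] it is at most 2;
     maximality of [f j] for the full product thus passes to [leja_prod f j]. *)
  apply: (le_trans le_g); rewrite -(@ler_pM2l _ 2)//.
  have := ejmax (r * g j); rewrite normrM r1 mul1r => /(_ gj1).
  rewrite ef !prodfE gjN -[1 + 1]/2%:R normr_nat => /le_trans; apply.
  rewrite ler_wpM2r ?leja_prod_ge0// (le_trans (ler_normD _ _))// normr1 normrX.
  by rewrite -[2]/(1 + 1) lerD2r exprn_ile1.
move=> z; rewrite big_split_ord /= eN.
have -> : \prod_(m < N) (z - e (N + m)%N) =
    r ^+ N * \prod_(m < N) (z / r - f m).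
  have -> : r ^+ N = \prod_(m < N) r by rewrite prodr_const card_ord.
  rewrite -big_split /=; apply: eq_bigr => m _.
  by rewrite ef mulrBr [r * (z / r)]mulrCA divff// mulr1.
(* Since [r ^+ N = -1], the second half contributes [z ^+ N + 1]. *)
rewrite (IH _ (fN N _))// expr_div_n rN exprD invrN1; ring.
Qed.

End LejaSections.

Theorem lemma2p3 (R : realType) (x : nat -> R) (hx : re_leja x) (n : nat) :
  [set x k | k in [set k : nat | (k <= 2 ^ n)%N]] = chebyshev_lobatto R (2 ^ n)%N.
Proof.
have [_ [e [e_leja x_dedup]]] := hx.
have [s [s_uniq s_size sE]] := chebyshev_lobatto_seq R (2 ^ n) (expn_gt0 2 n).
have e_prod :=
  leja_section_prod _ _ _ (leja_leja_section _ (2 ^ n.+1) _ e_leja).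
(* The length is doubled because conjugate roots share a real part: [2 ^ n.+1] roots yield only
   [2 ^ n + 1] values. *)
have es v : (exists2 i, (i < 2 ^ n.+1)%N & complex.Re (e i) = v) <-> v \in s.
  rewrite -sE -Re_root_of_unity; split=> [[i iN <-]|[z /= zN <-]].
    exists (e i) => //=; apply/eqP; rewrite -subr_eq0 -e_prod.
    by rewrite (bigD1 (Ordinal iN)) //= subrr mul0r.
  have /eqP := e_prod z; rewrite zN subrr => /prodf_eq0[i _].
  by rewrite subr_eq0 => /eqP ->; exists i.
have xs := dedup_of_take _ _ _ _ _ x_dedup s_uniq es.
by apply/seteqP; split=> v; rewrite sE -xs s_size.
Qed.
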